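(* Let $n\ge 1$, $m=2n-1$, and for $\sigma\in Z_m$ let $\mathcal{B}_\sigma=\{v\in\mathbb{R}^m_{\ge0}: v\cdot w\ge 0\text{ for all }w\in\sigma(V_n)\}$. Then $\mathbb{R}^m_{\ge 0}\subseteq\bigcup_{\sigma\in Z_m}\mathcal{B}_\sigma$, and for $\sigma_1\ne\sigma_2$ in $Z_m$ the interiors (in $\mathbb{R}^m$) of $\mathcal{B}_{\sigma_1}$ and $\mathcal{B}_{\sigma_2}$ are disjoint.
   Context: Let $m=2n-1$. The left ballot vectors are $L_n=\{w_1,\dots,w_{n-1}\}\subset\mathbb{R}^m$, where $w_k$ consists of $k$ copies of the pair $(1,-1)$ followed by $m-2k$ zeros; the right ballot vectors are $R_n=\{u_1,\dots,u_{n-1}\}$, where $u_k$ consists of $m-2k$ zeros followed by $k$ copies of the pair $(-1,1)$; $V_n=L_n\cup R_n$. $Z_m$ is the cyclic group of order $m$ generated by $\rho$, acting on $\mathbb{R}^m$ by cyclically shifting coordinates, $\rho([x_1,\dots,x_m])=[x_m,x_1,\dots,x_{m-1}]$ (e.g. $\rho^2([0,1,2,3,4])=[3,4,0,1,2]$), and $\sigma(V)=\{\sigma(v):v\in V\}$. *)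

(* Defs.v *)
From HB Require Import structures.
From mathcomp Require Import all_boot all_order all_algebra.
From mathcomp Require Import fingroup perm cyclic.
From mathcomp Require Import all_classical all_reals all_analysis.

Set Implicit Arguments.
Unset Strict Implicit.
Unset Printing Implicit Defensive.

Import Order.TTheory GRing.Theory Num.Theory.
Import numFieldNormedType.Exports.

Local Open Scope classical_set_scope.
Local Open Scope ring_scope.

(* Coordinates are numbered from 0: entry j is x_{j+1} of the usual indexing. *)

Definition rho (m : nat) : 'S_m := perm (@ordS_inj m).

Definition Zcyc (m : nat) : {group 'S_m} := <[rho m]>%G.

(* (s . x)_j = x_{s^-1 j}, so that rho moves each entry one place right. *)
Definition cshift (R : realType) (m : nat) (s : 'S_m) (x : 'rV[R]_m) : 'rV[R]_m :=
  col_perm s^-1%g x.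

Lemma cshift_rhoE (R : realType) (m : nat) (x : 'rV[R]_m) (j : 'I_m) :
  cshift (rho m) x 0 j = x 0 (ord_pred j).
Proof.
rewrite mxE; congr (x _ _); apply: (@perm_inj _ (rho m)).
by rewrite permKV permE ord_predK.
Qed.

Lemma rhoXE (m k : nat) (i : 'I_m) : (rho m ^+ k)%g i = ((i + k) %% m)%N :> nat.
Proof.
elim: k => [|k IHk]; first by rewrite perm1 addn0 modn_small.
by rewrite expgSr permM permE /= IHk -addn1 modnDml addn1 addnS.
Qed.

Lemma card_Zcyc (m : nat) : (0 < m)%N -> #|Zcyc m| = m.
Proof.
case: m => // m _; apply/eqP; rewrite eqn_dvd -orderE; apply/andP; split.
  rewrite order_dvdn; apply/eqP/permP => i; apply: val_inj.
  by rewrite /= rhoXE perm1 modnDr modn_small.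
have /permP/(_ ord0)/(congr1 val) := expg_order (rho m.+1).
by rewrite /= rhoXE perm1 add0n => /eqP.
Qed.

Definition left_ballot (R : realType) (m k : nat) : 'rV[R]_m :=
  \row_(j < m) (if (j < 2 * k)%N then (-1) ^+ j else 0).

(* The nonzero block starts at entry m - 2k with the value -1. *)
Definition right_ballot (R : realType) (m k : nat) : 'rV[R]_m :=
  \row_(j < m) (if (j < m - 2 * k)%N then 0 else (-1) ^+ (j - (m - 2 * k)).+1).

Definition left_ballots (R : realType) (n : nat) : set 'rV[R]_(2 * n - 1) :=
  [set left_ballot R (2 * n - 1) k | k in [set k : nat | (1 <= k <= n - 1)%N]].
Arguments left_ballots : clear implicits.

Definition right_ballots (R : realType) (n : nat) : set 'rV[R]_(2 * n - 1) :=
  [set right_ballot R (2 * n - 1) k | k in [set k : nat | (1 <= k <= n - 1)%N]].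
Arguments right_ballots : clear implicits.

Definition ballots (R : realType) (n : nat) : set 'rV[R]_(2 * n - 1) :=
  left_ballots R n `|` right_ballots R n.
Arguments ballots : clear implicits.

Definition dotp (R : realType) (m : nat) (v w : 'rV[R]_m) : R :=
  \sum_(j < m) v 0 j * w 0 j.

Definition orthant (R : realType) (m : nat) : set 'rV[R]_m :=
  [set v | forall j : 'I_m, 0 <= v 0 j].
Arguments orthant : clear implicits.

Definition ballot_cone (R : realType) (n : nat) (s : 'S_(2 * n - 1)) :
    set 'rV[R]_(2 * n - 1) :=
  [set v | orthant R (2 * n - 1) v /\
           forall w, (cshift s @` ballots R n) w -> 0 <= dotp v w].
Arguments ballot_cone : clear implicits.

(* Main.v *)
Require Import Defs.
From HB Require Import structures.
From mathcomp Require Import all_boot all_order all_algebra.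
From mathcomp Require Import fingroup perm cyclic.
From mathcomp Require Import all_classical all_reals all_analysis.
From mathcomp Require Import zify lra.
Import Order.TTheory GRing.Theory Num.Theory.
Import numFieldNormedType.Exports.
Local Open Scope classical_set_scope.
Local Open Scope ring_scope.

                                                      
                                                                            
                                                              
                                                                        
                                                                            
                                                                            
                                                                             
                                                                            
                                                                 
                                                                       
                                                                           
                 

(** Extend $v$ to an $m$-periodic sequence $f$ and put $F(i)=\sum_{j<i}(-1)^j f(j)$. As $m$ is odd,
    $F(i+m)=F(m)-F(i)$, so $k\mapsto F(2k)$ is a function on $\mathbb{Z}/m$ ([alt_sum_modn]). Since
    2 is invertible mod $m$, every element of $Z_m$ is some $\rho^{2k}$ with $k<m$. Pairing $v$ with
    $\rho^{2k}w$ for a ballot vector $w$ gives $F(2k')-F(2k)$ ([dotp_left_shift],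
    [dotp_right_shift]), and $k'$ runs over all residues other than $k$ as $w$ varies. So a vector
    $v$ of the orthant lies in the cone of $\rho^{2k}$ exactly when $k$ minimizes $F(2\,\cdot)$.

    A minimum exists, hence the covering. In the interior the inequalities are strict
    ([interior_ballot_cone]), so the minimizer is unique and two interiors cannot meet. *)

Definition alt_sum (R : pzRingType) (f : nat -> R) (i : nat) : R :=
  \sum_(0 <= j < i) (-1) ^+ j * f j.

Section AlternatingSums.
Variables (R : pzRingType) (m : nat) (f : nat -> R).
Hypotheses (m_odd : odd m) (f_per : forall i, f (i + m) = f i).

Lemma alt_sumDl (p a b : nat) : ~~ odd p -> (a <= b)%N ->
  \sum_(a <= i < b) (-1) ^+ i * f (i + p) =
  alt_sum R f (b + p) - alt_sum R f (a + p).
Proof.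
move=> p_even ab; rewrite /alt_sum (big_cat_nat _ (n := a + p) (p := b + p)) ?leq_add2r //=.
rewrite addrAC subrr add0r big_addn addnK.
by apply: eq_bigr => i _; rewrite exprD -[(-1) ^+ p]signr_odd (negbTE p_even) mulr1.
Qed.

(** Moving by the odd period $m$ preserves the terms but flips their signs. *)
Lemma alt_sumDm (i : nat) : alt_sum R f (i + m) = alt_sum R f m - alt_sum R f i.
Proof.
rewrite /alt_sum (big_cat_nat _ (n := m)) //= ?leq_addl //; congr (_ + _).
rewrite -{1}[m]add0n big_addn addnK -sumrN; apply: eq_bigr => j _.
by rewrite f_per exprD -[(-1) ^+ m]signr_odd m_odd mulrN1 mulNr.
Qed.

Lemma alt_sum_periodic (i : nat) : alt_sum R f (i + m + m) = alt_sum R f i.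
Proof. by rewrite !alt_sumDm subKr. Qed.

Lemma alt_sum_modn (k : nat) : alt_sum R f (2 * (k %% m)) = alt_sum R f (2 * k).
Proof.
rewrite {2}(divn_eq k m); elim: (k %/ m)%N => [|q IHq]; first by rewrite mul0n.
have -> : (2 * (q.+1 * m + k %% m) = 2 * (q * m + k %% m) + m + m)%N by lia.
by rewrite alt_sum_periodic.
Qed.

End AlternatingSums.

Lemma ltn0_ballot_dim (n : nat) : (1 <= n)%N -> (0 < 2 * n - 1)%N.
Proof. lia. Qed.

Lemma odd_ballot_dim (n : nat) : (1 <= n)%N -> odd (2 * n - 1).
Proof. lia. Qed.

Lemma sum_left_ballot (R : realType) (m k : nat) (g : nat -> R) : (2 * k <= m)%N ->
  \sum_(i < m) g i * left_ballot R m k 0 i = \sum_(0 <= i < 2 * k) (-1) ^+ i * g i.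
Proof.
move=> km; rewrite (big_nat_widen _ _ _ _ _ km) big_mkord [RHS]big_mkcond /=.
by apply: eq_bigr => i _; rewrite mxE /=; case: ifP; rewrite ?mulr0 // mulrC.
Qed.

(** The block starts with $-1$ at the index $m-2k$, which is odd because $m$ is; hence its signs are
    again $(-1)^i$, as for the left vectors. *)
Lemma sum_right_ballot (R : realType) (m k : nat) (g : nat -> R) :
  odd m -> (2 * k <= m)%N ->
  \sum_(i < m) g i * right_ballot R m k 0 i =
  \sum_(m - 2 * k <= i < m) (-1) ^+ i * g i.
Proof.
move=> m_odd km; rewrite (big_nat_widenl _ 0%N) // big_mkord [RHS]big_mkcond /=.
apply: eq_bigr => i _; rewrite mxE /= ltnNge; case: leqP => [ki|_]; last first.
  by rewrite mulr0.
rewrite mulrC -[in LHS]signr_odd -[in RHS]signr_odd; congr ((-1) ^+ _ * _).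
lia.
Qed.

Lemma dotp_cshift (R : realType) (m : nat) (s : 'S_m) (v w : 'rV[R]_m) :
  dotp v (cshift s w) = \sum_(i < m) v 0 (s i) * w 0 i.
Proof.
rewrite /dotp (reindex_inj (@perm_inj _ s)) /=.
by apply: eq_bigr => i _; rewrite mxE permK.
Qed.

Lemma dotpBl (R : realType) (m : nat) (u v w : 'rV[R]_m) :
  dotp (u - v) w = dotp u w - dotp v w.
Proof. by rewrite /dotp -sumrB; apply: eq_bigr => i _; rewrite !mxE mulrBl. Qed.

Lemma dotpZl (R : realType) (m : nat) (t : R) (v w : 'rV[R]_m) :
  dotp (t *: v) w = t * dotp v w.
Proof. by rewrite /dotp mulr_sumr; apply: eq_bigr => i _; rewrite !mxE mulrA. Qed.

Definition periodize (R : realType) (m : nat) (m_gt0 : (0 < m)%N) (v : 'rV[R]_m)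
    (i : nat) : R :=
  v 0 ((rho m ^+ i)%g (Ordinal m_gt0)).

Section Periodize.
Variables (R : realType) (m : nat) (m_gt0 : (0 < m)%N) (v : 'rV[R]_m).

Lemma periodize_periodic (i : nat) :
  periodize R m m_gt0 v (i + m) = periodize R m m_gt0 v i.
Proof.
by congr (v _ _); apply: val_inj; rewrite /= !rhoXE !add0n modnDr.
Qed.

Lemma periodizeE (p : nat) (i : 'I_m) :
  v 0 ((rho m ^+ p)%g i) = periodize R m m_gt0 v (i + p).
Proof. by congr (v _ _); apply: val_inj; rewrite /= !rhoXE add0n. Qed.

End Periodize.

Lemma Zcyc_even_shift (n : nat) (s : 'S_(2 * n - 1)) : (1 <= n)%N ->
  s \in Zcyc (2 * n - 1) ->
  exists2 k, (k < 2 * n - 1)%N & s = (rho (2 * n - 1) ^+ (2 * k))%g.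
Proof.
move=> n1 /cycleP [e ->]; set m := (2 * n - 1)%N.
(* $n$ is the inverse of 2 modulo $m$, since $2n=m+1$. *)
exists (e * n %% m)%N; first by rewrite ltn_mod ltn0_ballot_dim.
apply/permP => i; apply: val_inj; rewrite /= !rhoXE.
rewrite -[RHS]modnDmr modnMmr modnDmr.
have -> : (i + 2 * (e * n) = e * m + (i + e))%N.
  have : (2 * n = m + 1)%N by rewrite /m; lia.
  nia.
by rewrite modnMDl.
Qed.

Section BallotCone.
Variables (R : realType) (n : nat) (n_ge1 : (1 <= n)%N).
Local Notation m := (2 * n - 1)%N.
Local Notation F v i :=
  (alt_sum R (periodize R m (ltn0_ballot_dim _ n_ge1) v) i).

Lemma dotp_left_shift (v : 'rV[R]_m) (k l : nat) : (l <= n - 1)%N ->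
  dotp v (cshift (rho m ^+ (2 * k))%g (left_ballot R m l)) =
  F v (2 * (k + l)) - F v (2 * k).
Proof.
move=> ln; rewrite dotp_cshift.
under eq_bigr do rewrite (periodizeE _ _ (ltn0_ballot_dim _ n_ge1)).
rewrite (sum_left_ballot _ _ _ (fun i => periodize R m _ v (i + 2 * k))); last lia.
by rewrite alt_sumDl ?oddM // add0n -mulnDr addnC.
Qed.

Lemma dotp_right_shift (v : 'rV[R]_m) (k l : nat) : (l <= n - 1)%N ->
  dotp v (cshift (rho m ^+ (2 * k))%g (right_ballot R m l)) =
  F v (2 * (k + (m - l))) - F v (2 * k).
Proof.
move=> ln; rewrite dotp_cshift.
under eq_bigr do rewrite (periodizeE _ _ (ltn0_ballot_dim _ n_ge1)).
have m_odd := odd_ballot_dim _ n_ge1.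
rewrite (sum_right_ballot _ _ _ (fun i => periodize R m _ v (i + 2 * k))) //; last lia.
rewrite alt_sumDl ?oddM ?leq_subr //.
(* Both $F(m+2k)$ and $F(2(k+m-l))$ are now reflected by [alt_sumDm], which turns the odd arguments
   of the sum into even ones. *)
have -> : (2 * (k + (m - l)) = m - 2 * l + 2 * k + m)%N by lia.
rewrite [(m + 2 * k)%N]addnC !(alt_sumDm _ m) //; try exact: periodize_periodic.
by rewrite addrAC.
Qed.

Lemma dotp_ballot_alt_sum (v w : 'rV[R]_m) (k : nat) : ballots R n w ->
  exists k', dotp v (cshift (rho m ^+ (2 * k))%g w) = F v (2 * k') - F v (2 * k).
Proof.
by move=> [] [l /andP[_ ln] <-]; eexists;
  [exact: dotp_left_shift | exact: dotp_right_shift].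
Qed.

(** With $d=k'-k$ modulo $m$, the left vectors account for $1\le d\le n-1$ and the right ones for
    $n\le d\le m-1$. *)
Lemma alt_sum_dotp_ballot (v : 'rV[R]_m) (k k' : nat) :
  (k < m)%N -> (k' < m)%N -> k <> k' ->
  exists2 w, ballots R n w &
    dotp v (cshift (rho m ^+ (2 * k))%g w) = F v (2 * k') - F v (2 * k).
Proof.
move=> km k'm kk'.
have [d [d_gt0 dm ->]] : exists d, [/\ (0 < d)%N, (d < m)%N & k' = ((k + d) %% m)%N].
  have [lt_kk'|le_k'k] := ltnP k k'.
    by exists (k' - k)%N; split; [lia|lia|rewrite subnKC ?modn_small // ltnW].
  exists (m - k + k')%N; split; [lia|lia|].
  by rewrite addnA subnKC ?modnDl ?modn_small // ltnW.
rewrite alt_sum_modn; [|exact: odd_ballot_dim|exact: periodize_periodic].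
have [dn|nd] := ltnP d n.
  by exists (left_ballot R m d); [left; exists d => //=; lia|apply: dotp_left_shift; lia].
exists (right_ballot R m (m - d)); first by right; exists (m - d)%N => //=; lia.
by rewrite dotp_right_shift; [rewrite subKn // ltnW|lia].
Qed.

(** A direction along which all ballot inequalities change at the same rate: each ballot vector has
    entries $1,0$ or $0,1$ at its two ends. For $n=1$ the ends coincide and the single entry is
    2. *)
Definition ends_vector : 'rV[R]_m :=
  \row_(j < m) ((val j == 0%N)%:R + (val j == m.-1)%:R).

Lemma dotp_ends_ballot (s : 'S_m) (w : 'rV[R]_m) : ballots R n w ->
  dotp (cshift s ends_vector) (cshift s w) = 1.
Proof.
have m_odd := odd_ballot_dim _ n_ge1.
move=> [] [l /andP[l1 ln] <-]; rewrite dotp_cshift.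
all: under eq_bigr do rewrite !mxE permK mulrDl.
all: rewrite big_split /=.
all: have im : (m.-1 < m)%N by lia.
all: rewrite (bigD1 (Ordinal (ltn0_ballot_dim _ n_ge1))) //= big1 => [|i /negPf i0];
  last by rewrite -[(i == 0 :> nat)]/(i == Ordinal (ltn0_ballot_dim _ n_ge1)) i0 mul0r.
all: rewrite (bigD1 (Ordinal im)) //= big1 => [|i /negPf i0];
  last by rewrite -[(i == _ :> nat)]/(i == Ordinal im) i0 mul0r.
all: rewrite !eqxx !mul1r !addr0.
- rewrite ifT; last lia.
  by rewrite ifF ?addr0 //; lia.
- rewrite ifT; last lia.
  rewrite ifF; last lia.
  rewrite add0r -signr_odd.
  suff -> : odd (m.-1 - (m - 2 * l)).+1 = false by [].
  lia.
Qed.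

Lemma interior_ballot_cone (s : 'S_m) (v w : 'rV[R]_m) :
  interior (ballot_cone R n s) v -> ballots R n w -> 0 < dotp v (cshift s w).
Proof.
move=> /nbhs_ballP [e /= e_gt0 sub_ball] bw.
(* A small step against [ends_vector] stays in the cone and lowers every pairing by $e/3$. Entries
   of [ends_vector] are at most 2, so $e/3$ keeps the step inside the open ball of radius $e$. *)
have [_ /(_ (cshift s w))] : ballot_cone R n s (v - (e / 3) *: cshift s ends_vector).
  apply: sub_ball; split=> // i j; rewrite /ball /= ord1 !mxE opprB addrC subrK.
  by case: (_ == _); case: (_ == _); rewrite ger0_norm /=; lra.
rewrite dotpBl dotpZl dotp_ends_ballot // mulr1 => H.
have : 0 <= dotp v (cshift s w) - e / 3 by apply: H; exists w.
by rewrite subr_ge0; apply: lt_le_trans; lra.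
Qed.

Lemma orthant_sub_ballot_cones :
  orthant R m `<=` \bigcup_(s in [set s : 'S_m | s \in Zcyc m]) ballot_cone R n s.
Proof.
move=> v v_ge0.
case: (arg_minP (fun k : 'I_m => F v (2 * k)) (P := xpredT)
  (i0 := Ordinal (ltn0_ballot_dim _ n_ge1))) => // k _ kmin.
exists (rho m ^+ (2 * k))%g; first by rewrite /= mem_cycle.
split=> // _ [w bw <-]; have [k' ->] := dotp_ballot_alt_sum v w k bw.
(* The index $k'$ may exceed $m$, while minimality is known only below $m$. *)
have k'm : (k' %% m < m)%N by rewrite ltn_mod ltn0_ballot_dim.
rewrite subr_ge0; apply: le_trans (kmin (Ordinal k'm) isT) _.
by rewrite /= alt_sum_modn //; [exact: odd_ballot_dim|exact: periodize_periodic].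
Qed.

Lemma interior_alt_sum_lt (v : 'rV[R]_m) (k k' : nat) :
  (k < m)%N -> (k' < m)%N -> k <> k' ->
  interior (ballot_cone R n (rho m ^+ (2 * k))%g) v -> F v (2 * k) < F v (2 * k').
Proof.
move=> km k'm kk' vint.
have [w bw E] := alt_sum_dotp_ballot v k k' km k'm kk'.
by rewrite -subr_gt0 -E; apply: interior_ballot_cone.
Qed.

End BallotCone.

Theorem theorem2p7 (R : realType) (n : nat) (n_ge1 : (1 <= n)%N) :
  (orthant R (2 * n - 1) `<=`
     \bigcup_(s in [set s : 'S_(2 * n - 1) | s \in Zcyc (2 * n - 1)])
        ballot_cone R n s) /\
  (forall s1 s2 : 'S_(2 * n - 1),
     s1 \in Zcyc (2 * n - 1) -> s2 \in Zcyc (2 * n - 1) -> s1 <> s2 ->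
     interior (ballot_cone R n s1) `&` interior (ballot_cone R n s2) = set0).
Proof.
split; first exact: orthant_sub_ballot_cones.
move=> s1 s2 /Zcyc_even_shift [//|k1 k1m ->] /Zcyc_even_shift [//|k2 k2m ->] s12.
have k12 : k1 <> k2 by move=> E; apply: s12; rewrite E.
rewrite -subset0 => v [v1 v2].
have /lt_trans := interior_alt_sum_lt R n n_ge1 v k1 k2 k1m k2m k12 v1.
have k21 : k2 <> k1 by move=> E; apply: k12.
move=> /(_ _ (interior_alt_sum_lt R n n_ge1 v k2 k1 k2m k1m k21 v2)).
by rewrite ltxx.
Qed.
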